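(* For $n\ge 0$ let $f(n)$ be the number of distinct words of length $2n$ that are factors of the Thue–Morse word $\mathbf t$ and are abelian squares (for $n=0$ the empty word is counted, so $f(0)=1$). Let $v=[1,0,0,0,0,0,0,0,0,0,0]$, $w=[1,2,4,4,10,8,24,10,22,12,36]^T$, $$M_0=\begin{pmatrix} 1&0&0&0&0&0&0&0&0&0&0\\ 0&0&1&0&0&0&0&0&0&0&0\\ 0&0&0&0&1&0&0&0&0&0&0\\ 0&0&0&0&0&0&1&0&0&0&0\\ 0&0&0&0&0&0&0&0&1&0&0\\ 0&0&0&0&0&0&0&0&0&0&1\\ 0&0&\frac{64}{13}&1&-\frac{171}{26}&-\frac{69}{26}&0&0&\frac{43}{26}&\frac{9}{13}&\frac{51}{26}\\ 0&0&\frac{90}{13}&-1&-\frac{275}{26}&\frac{9}{26}&0&2&\frac{69}{26}&-\frac{17}{13}&\frac{51}{26}\\ 0&0&-2&0&1&0&0&0&2&0&0\\ 0&0&\frac{68}{13}&0&-\frac{88}{13}&-\frac{33}{13}&0&0&\frac{20}{13}&\frac{12}{13}&\frac{34}{13}\\ 0&0&\frac{54}{13}&0&-\frac{89}{13}&-\frac{22}{13}&0&0&\frac{35}{13}&\frac{8}{13}&\frac{27}{13} \end{pmatrix},$$ $$M_1=\begin{pmatrix} 0&1&0&0&0&0&0&0&0&0&0\\ 0&0&0&1&0&0&0&0&0&0&0\\ 0&0&0&0&0&1&0&0&0&0&0\\ 0&0&0&0&0&0&0&1&0&0&0\\ 0&0&0&0&0&0&0&0&0&1&0\\ 0&0&-\frac{8}{13}&0&-\frac{8}{13}&\frac{10}{13}&0&0&\frac{16}{13}&\frac{7}{13}&-\frac{4}{13}\\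 0&0&-\frac{87}{13}&-1&\frac{203}{26}&\frac{3}{26}&2&0&-\frac{3}{26}&\frac{16}{13}&-\frac{61}{26}\\ 0&0&-\frac{7}{13}&1&\frac{25}{26}&-\frac{93}{26}&0&0&\frac{15}{26}&\frac{37}{13}&-\frac{7}{26}\\ 0&0&\frac{20}{13}&0&-\frac{45}{13}&-\frac{12}{13}&0&0&\frac{25}{13}&\frac{28}{13}&-\frac{3}{13}\\ 0&0&-\frac{40}{13}&0&\frac{25}{13}&-\frac{2}{13}&0&0&\frac{15}{13}&\frac{22}{13}&-\frac{7}{13}\\ 0&0&-\frac{36}{13}&0&\frac{29}{13}&-\frac{20}{13}&0&0&\frac{7}{13}&\frac{38}{13}&-\frac{5}{13} \end{pmatrix}.$$ Then for every $n\ge 0$, if $a_1a_2\cdots a_i$ is the base-$2$ representation of $n$ (most significant digit first), one has $f(n)=vM_{a_1}M_{a_2}\cdots M_{a_i}w$. In particular $f$ is $2$-regular.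
   Context: The Thue–Morse word $\mathbf t=0110100110010110\cdots$ is the fixed point starting with $0$ of the morphism $\mu:0\mapsto 01,\ 1\mapsto 10$. An abelian square is a word $uv$ where $v$ is an anagram of $u$ (same number of each letter). The base-$2$ representation of $n$ is taken without leading zeros, with $0$ represented by the empty word (leading zeros do not affect the product since the first row of $M_0$ is $v$). A sequence is $2$-regular if it admits such a linear representation. *)

(* Defs.v *)
From HB Require Import structures.
From mathcomp Require Import all_boot all_order all_algebra.
From mathcomp Require Import boolp.

Set Implicit Arguments.
Unset Strict Implicit.
Unset Printing Implicit Defensive.

Import GRing.Theory.

(* The letters 0 and 1 (and the binary digits 0 and 1) are false and true;    *)
(* an infinite word over T is a function nat -> T.                            *)

Definition apply_morphism (A B : Type) (h : A -> seq B) (u : seq A) : seq B :=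
  flatten [seq h a | a <- u].

Definition mu (b : bool) : seq bool := [:: b; ~~ b].

Definition is_fixed_point (h : bool -> seq bool) (x : nat -> bool) : Prop :=
  forall n, let y := apply_morphism h (mkseq x n) in y = mkseq x (size y).

(* The n-th iterate of mu on 0 is a prefix, of length 2 ^ n > n, of the fixed *)
(* point; thue_morse_spec and thue_morse_unique below justify the definition. *)
Definition thue_morse (n : nat) : bool :=
  nth false (iter n (apply_morphism mu) [:: false]) n.

Definition is_factor (T : Type) (x : nat -> T) (u : seq T) : Prop :=
  exists i, u = [seq x j | j <- iota i (size u)].

Definition is_abelian_square (T : eqType) (u : seq T) : Prop :=
  exists u1 u2, u = u1 ++ u2 /\ perm_eq u1 u2.

Definition tm_abelian_squares (n : nat) : nat :=
  #|[set u : (2 * n).-tuple bool |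
      `[< is_factor thue_morse u /\ is_abelian_square u >]]|.

(* a lists the binary digits of n, most significant first, without leading    *)
(* zeros; in particular the representation of 0 is the empty word.            *)
Definition is_base2_rep (n : nat) (a : seq bool) : Prop :=
  head true a = true /\ n = foldl (fun m (b : bool) => m * 2 + b) 0 a.

Local Open Scope ring_scope.

Definition is_linear_rep (f : nat -> rat) (d : nat) (v : 'rV[rat]_d)
    (M : bool -> 'M[rat]_d) (w : 'cV[rat]_d) : Prop :=
  forall (n : nat) (a : seq bool), is_base2_rep n a ->
    f n = (v *m (\prod_(b <- a) M b) *m w) 0 0.

Definition two_regular (f : nat -> rat) : Prop :=
  exists (d : nat) (v : 'rV[rat]_d) (M : bool -> 'M[rat]_d) (w : 'cV[rat]_d),
    is_linear_rep f v M w.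

Definition mx_of_rows (m n : nat) (s : seq (seq rat)) : 'M[rat]_(m, n) :=
  \matrix_(i, j) nth 0 (nth [::] s i) j.

Definition tm_v : 'rV[rat]_11 :=
  mx_of_rows 1 11 [:: [:: 1; 0; 0; 0; 0; 0; 0; 0; 0; 0; 0]].

Definition tm_w : 'cV[rat]_11 :=
  (mx_of_rows 1 11 [:: [:: 1; 2; 4; 4; 10; 8; 24; 10; 22; 12; 36]])^T.

Definition tm_M0 : 'M[rat]_11 := mx_of_rows 11 11 [::
    [:: 1; 0; 0; 0; 0; 0; 0; 0; 0; 0; 0];
    [:: 0; 0; 1; 0; 0; 0; 0; 0; 0; 0; 0];
    [:: 0; 0; 0; 0; 1; 0; 0; 0; 0; 0; 0];
    [:: 0; 0; 0; 0; 0; 0; 1; 0; 0; 0; 0];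
    [:: 0; 0; 0; 0; 0; 0; 0; 0; 1; 0; 0];
    [:: 0; 0; 0; 0; 0; 0; 0; 0; 0; 0; 1];
    [:: 0; 0; 64 / 13; 1; -171 / 26; -69 / 26; 0; 0; 43 / 26; 9 / 13; 51 / 26];
    [:: 0; 0; 90 / 13; -1; -275 / 26; 9 / 26; 0; 2; 69 / 26; -17 / 13; 51 / 26];
    [:: 0; 0; -2; 0; 1; 0; 0; 0; 2; 0; 0];
    [:: 0; 0; 68 / 13; 0; -88 / 13; -33 / 13; 0; 0; 20 / 13; 12 / 13; 34 / 13];
    [:: 0; 0; 54 / 13; 0; -89 / 13; -22 / 13; 0; 0; 35 / 13; 8 / 13; 27 / 13]].

Definition tm_M1 : 'M[rat]_11 := mx_of_rows 11 11 [::
    [:: 0; 1; 0; 0; 0; 0; 0; 0; 0; 0; 0];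
    [:: 0; 0; 0; 1; 0; 0; 0; 0; 0; 0; 0];
    [:: 0; 0; 0; 0; 0; 1; 0; 0; 0; 0; 0];
    [:: 0; 0; 0; 0; 0; 0; 0; 1; 0; 0; 0];
    [:: 0; 0; 0; 0; 0; 0; 0; 0; 0; 1; 0];
    [:: 0; 0; -8 / 13; 0; -8 / 13; 10 / 13; 0; 0; 16 / 13; 7 / 13; -4 / 13];
    [:: 0; 0; -87 / 13; -1; 203 / 26; 3 / 26; 2; 0; -3 / 26; 16 / 13; -61 / 26];
    [:: 0; 0; -7 / 13; 1; 25 / 26; -93 / 26; 0; 0; 15 / 26; 37 / 13; -7 / 26];
    [:: 0; 0; 20 / 13; 0; -45 / 13; -12 / 13; 0; 0; 25 / 13; 28 / 13; -3 / 13];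
    [:: 0; 0; -40 / 13; 0; 25 / 13; -2 / 13; 0; 0; 15 / 13; 22 / 13; -7 / 13];
    [:: 0; 0; -36 / 13; 0; 29 / 13; -20 / 13; 0; 0; 7 / 13; 38 / 13; -5 / 13]].

Definition tm_M (b : bool) : 'M[rat]_11 := if b then tm_M1 else tm_M0.

Local Close Scope ring_scope.

Lemma size_apply_mu u : size (apply_morphism mu u) = (size u).*2.
Proof. by rewrite /apply_morphism; elim: u => //= a u ->; rewrite doubleS. Qed.

Lemma nth_apply_mu u n : n < (size u).*2 ->
  nth false (apply_morphism mu u) n = nth false u n./2 (+) odd n.
Proof.
elim: u n => [|a u IH] [|[|n]] //=; first by rewrite addbF.
  by rewrite addbT.
by rewrite doubleS !ltnS => /IH; rewrite /apply_morphism negbK.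
Qed.

Lemma size_mu_iter k : size (iter k (apply_morphism mu) [:: false]) = 2 ^ k.
Proof. by elim: k => //= k IH; rewrite size_apply_mu IH expnS mul2n. Qed.

Lemma nth_mu_iter k n : n < 2 ^ k ->
  nth false (iter k (apply_morphism mu) [:: false]) n = thue_morse n.
Proof.
rewrite /thue_morse.
have H k' m : m < 2 ^ k' ->
    nth false (iter k'.+1 (apply_morphism mu) [:: false]) m =
    nth false (iter k' (apply_morphism mu) [:: false]) m.
  elim: k' m => [|k' IH] m lt_m; first by case: m lt_m.
  have lt2 : m < (2 ^ k').*2 by rewrite -mul2n -expnS.
  rewrite iterS nth_apply_mu ?size_mu_iter; last first.
    by rewrite (leq_trans lt_m) // -addnn leq_addr.
  rewrite IH ?ltn_half_double // iterS nth_apply_mu ?size_mu_iter //.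
have H2 k1 j m : m < 2 ^ k1 ->
    nth false (iter (j + k1) (apply_morphism mu) [:: false]) m =
    nth false (iter k1 (apply_morphism mu) [:: false]) m.
  move=> lt_m; elim: j => // j IH; rewrite addSn H ?IH //.
  by rewrite (leq_trans lt_m) // leq_exp2l // leq_addl.
by move=> lt_n; rewrite -(H2 _ n) // addnC H2 // ltn_expl.
Qed.

Lemma thue_morseE n : thue_morse n = thue_morse n./2 (+) odd n.
Proof.
have lt_n : n < 2 ^ n by rewrite ltn_expl.
have lt2 : n < (2 ^ n).*2 by rewrite (leq_trans lt_n) // -addnn leq_addr.
rewrite -(@nth_mu_iter n.+1 n) ?expnS ?mul2n // iterS.
by rewrite nth_apply_mu ?size_mu_iter // nth_mu_iter // ltn_half_double.
Qed.

Lemma thue_morse_spec : thue_morse 0 = false /\ is_fixed_point mu thue_morse.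
Proof.
split=> // n y; rewrite {}/y; apply: (@eq_from_nth _ false); first by rewrite size_mkseq.
move=> i; rewrite size_apply_mu size_mkseq => lt_i.
rewrite nth_apply_mu ?size_mkseq // !nth_mkseq ?ltn_half_double //.
by rewrite -thue_morseE.
Qed.

Lemma thue_morse_unique (x : nat -> bool) :
  x 0 = false -> is_fixed_point mu x -> x =1 thue_morse.
Proof.
move=> x0 fx; elim/ltn_ind => n IH.
case: n IH => [|n] IH; first by rewrite x0.
have lt2 : n.+1 < n.+2.*2 by rewrite -addnn leq_addr.
have := congr1 (nth false ^~ n.+1) (fx n.+2).
rewrite size_apply_mu size_mkseq nth_apply_mu ?size_mkseq //.
have lt3 : uphalf n < n.+1 by rewrite ltnS leq_uphalf_double -addnn leq_addr.
rewrite -[n.+1./2]/(uphalf n) !nth_mkseq // ?(ltn_trans lt3) // => <-.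
by rewrite thue_morseE IH.
Qed.

Lemma base2_rep_exists n : exists a, is_base2_rep n a.
Proof.
elim/ltn_ind: n => -[|n] IH; first by exists [::].
have lt3 : n.+1./2 < n.+1 by rewrite ltnS /= leq_uphalf_double -addnn leq_addr.
have [a [ha va]] := IH _ lt3; exists (rcons a (odd n.+1)); split.
  by case: a ha va => //=; case: n {IH lt3} => [|[]].
rewrite -cats1 foldl_cat -va -[foldl _ _ [:: _]]/(n.+1./2 * 2 + odd n.+1).
by rewrite muln2 addnC odd_double_half.
Qed.

(* Main.v *)
(* For L > 3 the factors of length L of the Thue-Morse word split, according to
   the parity of their position, into images under mu of shorter factors.  As
   mu a always contains one 0 and one 1, an abelian square of length 2n comes
   from a factor y subject only to conditions comparing its two end letters with
   a letter at or near its middle.  The numbers of factors satisfying such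
   conditions, for four placements of the middle letter (Triple, TripleS, Left,
   Right), together with the number of factors of length 2n and f itself, are 18
   sequences whose values at 2n+b are sums of their values at n, for n > 0.

   Let r(n) be the row v M_(a_1) ... M_(a_i).  The relation
   phi(2i+b) = sum_j (M_b)_(i,j) phi(j) holds for each of the 18 sequences phi
   and 1 <= i <= 10, which is a finite computation; by the recursions and
   linearity it propagates to phi(n) = sum_j r(n)_j phi(j) for all n > 0.  For
   phi = f this is the theorem, since w_j = f(j). *)

Require Import Defs.
From mathcomp Require Import all_boot all_order all_algebra.
From mathcomp Require Import boolp zify.

Set Implicit Arguments.
Unset Strict Implicit.
Unset Printing Implicit Defensive.

Local Notation t := thue_morse.

(** * Windows of [t] and their preimages under [mu] *)

Definition window (i L : nat) : seq bool := [seq t j | j <- iota i L].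

Lemma size_window i L : size (window i L) = L.
Proof. by rewrite size_map size_iota. Qed.

Lemma nth_window i L k : k < L -> nth false (window i L) k = t (i + k).
Proof. by move=> ltkL; rewrite (nth_map 0) ?size_iota // nth_iota. Qed.

Lemma thue_morse_double n : t n.*2 = t n.
Proof. by rewrite thue_morseE odd_double doubleK addbF. Qed.

Lemma thue_morse_doubleS n : t n.*2.+1 = ~~ t n.
Proof. by rewrite thue_morseE /= odd_double uphalf_double addbT. Qed.

(** One of n, n + 1 is even, and [mu] puts different letters at positions 2m and 2m + 1. *)
Lemma thue_morse_cubefree n : ~ (t n = t n.+1 /\ t n.+1 = t n.+2).
Proof.
case=> e1 e2; have [on | en] := boolP (odd n); last first.
  by move: e1; rewrite -(even_halfK en) thue_morse_double thue_morse_doubleS; case: (t _).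
have en : ~~ odd n.+1 by rewrite /= on.
by move: e2; rewrite -(even_halfK en) thue_morse_double thue_morse_doubleS; case: (t _).
Qed.

(* The factors of length L at even, resp. odd, positions are mu_even L y, resp.
   mu_odd L y, for a unique factor y of length uphalf L, resp. L./2.+1. *)
Definition mu_even (L : nat) (y : seq bool) := take L (apply_morphism mu y).
Definition mu_odd (L : nat) (y : seq bool) :=
  take L (behead (apply_morphism mu y)).

Lemma nth_mu_even L y k : uphalf L <= size y -> k < L ->
  nth false (mu_even L y) k = nth false y k./2 (+) odd k.
Proof. by move=> leL ltk; rewrite nth_take // nth_apply_mu //; lia. Qed.

Lemma nth_mu_odd L y k : L./2.+1 <= size y -> k < L ->
  nth false (mu_odd L y) k = nth false y (uphalf k) (+) ~~ odd k.
Proof. by move=> leL ltk; rewrite nth_take // nth_behead nth_apply_mu //; lia. Qed.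

Lemma size_mu_even L y : uphalf L <= size y -> size (mu_even L y) = L.
Proof. by move=> leL; rewrite size_takel // size_apply_mu; lia. Qed.

Lemma size_mu_odd L y : L./2.+1 <= size y -> size (mu_odd L y) = L.
Proof. by move=> leL; rewrite size_takel // size_behead size_apply_mu; lia. Qed.

Lemma mu_even_window L i : mu_even L (window i (uphalf L)) = window i.*2 L.
Proof.
apply: (@eq_from_nth _ false); rewrite size_mu_even ?size_window // => k ltk.
rewrite nth_mu_even ?size_window // !nth_window //; last by lia.
by rewrite [RHS]thue_morseE oddD odd_double halfD odd_double doubleK add0n.
Qed.

Lemma mu_odd_window L i : mu_odd L (window i L./2.+1) = window i.*2.+1 L.
Proof.
apply: (@eq_from_nth _ false); rewrite size_mu_odd ?size_window // => k ltk.
rewrite nth_mu_odd ?size_window // !nth_window //; last by lia.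
by rewrite [RHS]thue_morseE; congr (t _ (+) _); lia.
Qed.

Lemma mu_even_inj L : {in [pred y | size y == uphalf L] &, injective (mu_even L)}.
Proof.
move=> y z /eqP sy /eqP sz eyz; apply: (@eq_from_nth _ false) => [|k]; first by rewrite sz.
rewrite sy => ltk; have := congr1 (nth false ^~ k.*2) eyz.
by rewrite !nth_mu_even ?sy ?sz // ?odd_double ?doubleK ?addbF //; lia.
Qed.

Lemma mu_odd_inj L : 0 < L -> {in [pred y | size y == L./2.+1] &, injective (mu_odd L)}.
Proof.
move=> L_gt0 y z /eqP sy /eqP sz eyz.
apply: (@eq_from_nth _ false) => [|k]; first by rewrite sz.
(* Letter k of y is read at position 2k - 1; for k = 0 truncation gives position 0, which holds the
   negation of letter 0. *)
rewrite sy => ltk; have := congr1 (nth false ^~ k.*2.-1) eyz.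
rewrite !nth_mu_odd ?sy ?sz //; try lia.
have -> : uphalf k.*2.-1 = k by lia.
by apply: addIb.
Qed.

(** Equality of the first four letters would already force [t] to agree at k, k + 1 and k + 2. *)
Lemma window_even_odd i k L : 3 < L -> window i.*2 L <> window k.*2.+1 L.
Proof.
move=> ltL e.
have E m : m < L -> t (i.*2 + m) = t (k.*2.+1 + m).
  by move=> ltm; have := congr1 (nth false ^~ m) e; rewrite !nth_window.
have := E 0 _; have := E 1 _; have := E 2 _; have := E 3 _.
rewrite !addn0 !addn1 !addn2 !addn3 -!doubleS !(thue_morse_double, thue_morse_doubleS).
move=> /(_ ltL) e3 /(_ (ltnW ltL)) e2 /(_ (ltn_trans _ ltL)) e1 /(_ (ltn_trans _ ltL)) e0.
apply: (@thue_morse_cubefree k); move: e3 e2 (e1 isT) (e0 isT).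
by case: (t i); case: (t i.+1); case: (t k); case: (t k.+1); case: (t k.+2).
Qed.

(** * Enumeration of the factors of a given length *)

Definition enumerates_factors (L : nat) (s : seq (seq bool)) : Prop :=
  uniq s /\ forall u, u \in s <-> size u = L /\ is_factor t u.

Lemma enumerates_window L s : enumerates_factors L s ->
  forall u, u \in s <-> exists i, u = window i L.
Proof.
case=> _ h u; rewrite h; split=> [[<- [i ->]] | [i ->]]; first by exists i; rewrite size_map size_iota.
by rewrite size_window; split=> //; exists i; rewrite size_window.
Qed.

Lemma enumerates_perm L s1 s2 :
  enumerates_factors L s1 -> enumerates_factors L s2 -> perm_eq s1 s2.
Proof.
case=> u1 h1 [u2 h2]; apply: uniq_perm => // u.
by apply/idP/idP; rewrite h1 h2.
Qed.

Lemma enumerates_rec L s1 s2 : 3 < L ->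
  enumerates_factors (uphalf L) s1 -> enumerates_factors L./2.+1 s2 ->
  enumerates_factors L ([seq mu_even L y | y <- s1] ++ [seq mu_odd L y | y <- s2]).
Proof.
move=> ltL e1 e2; have [w1 w2] := (enumerates_window e1, enumerates_window e2).
case: e1 e2 => u1 h1 [u2 h2]; split.
  rewrite cat_uniq; apply/and3P; split.
  - by rewrite map_inj_in_uniq // => y z /h1[sy _] /h1[sz _];
       apply: mu_even_inj; apply/eqP.
  - apply/hasP => -[u /mapP[y /w2[i ->] ->] /mapP[z /w1[j ->]]].
    by rewrite mu_even_window mu_odd_window => /esym; apply: window_even_odd.
  - by rewrite map_inj_in_uniq // => y z /h2[sy _] /h2[sz _];
       apply: mu_odd_inj; rewrite ?(ltn_trans _ ltL) //; apply/eqP.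
move=> u; rewrite mem_cat; split.
  case/orP=> /mapP[y].
    case/w1=> i -> ->; rewrite mu_even_window size_window; split=> //.
    by exists i.*2; rewrite size_window.
  case/w2=> i -> ->; rewrite mu_odd_window size_window; split=> //.
  by exists i.*2.+1; rewrite size_window.
case=> su [i]; rewrite su -/(window i L) => ->.
have [oi | ei] := boolP (odd i); apply/orP; [right | left]; apply/mapP.
  exists (window i./2 L./2.+1); first by apply/w2; exists i./2.
  by rewrite mu_odd_window; congr window; lia.
exists (window i./2 (uphalf L)); first by apply/w1; exists i./2.
by rewrite mu_even_window; congr window; lia.
Qed.

Definition short_factors (L : nat) : seq (seq bool) :=
  match L with
  | 0 => [:: [::]]
  | 1 => [:: [:: false]; [:: true]]
  | 2 => [seq [:: a; b] | a <- [:: false; true], b <- [:: false; true]]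
  | _ => [:: [:: false; false; true]; [:: false; true; false];
             [:: false; true; true]; [:: true; false; false];
             [:: true; false; true]; [:: true; true; false]]
  end.

(* Both recursive calls are at smaller lengths as soon as 3 < L, so that L is
   enough fuel for length L. *)
Fixpoint factors_fuel (k L : nat) : seq (seq bool) :=
  if L <= 3 then short_factors L else
  if k is k'.+1 then
    [seq mu_even L y | y <- factors_fuel k' (uphalf L)] ++
    [seq mu_odd L y | y <- factors_fuel k' L./2.+1]
  else [::].

Definition factors (L : nat) := factors_fuel L L.

Lemma enumerates_short L : L <= 3 -> enumerates_factors L (short_factors L).
Proof.
(* The positions supplied below are occurrences within the prefix 01101001. *)
have W (u : seq bool) i : u == window i (size u) -> is_factor t u by move/eqP=> ?; exists i.
case: L => [|[|[|[|//]]]] _; split=> // u; split.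
- by rewrite inE => /eqP->; split=> //; apply: (W _ 0).
- by case=> /size0nil->.
- by rewrite !inE => /orP[] /eqP->; split=> //; [apply: (W _ 0) | apply: (W _ 1)]; vm_compute.
- by case: u => [|[] [|? ?]] [].
- rewrite !inE => /or4P[] /eqP->; split=> //.
  + by apply: (W _ 5); vm_compute.
  + by apply: (W _ 0); vm_compute.
  + by apply: (W _ 2); vm_compute.
  + by apply: (W _ 1); vm_compute.
- by case: u => [|[] [|[] [|? ?]]] [].
- rewrite !inE => /or4P[|||/or3P[]] /eqP->; split=> //.
  + by apply: (W _ 5); vm_compute.
  + by apply: (W _ 3); vm_compute.
  + by apply: (W _ 0); vm_compute.
  + by apply: (W _ 4); vm_compute.
  + by apply: (W _ 2); vm_compute.
  + by apply: (W _ 1); vm_compute.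
- case=> su [i]; rewrite su /= => ->; move: (@thue_morse_cubefree i).
  by case: (t i); case: (t i.+1); case: (t i.+2) => // -[].
Qed.

Lemma enumerates_factors_fuel k L : L <= k + 3 -> enumerates_factors L (factors_fuel k L).
Proof.
elim: k L => [|k IH] L leL; rewrite /=.
  by rewrite leL; apply: enumerates_short.
case: leqP => [|ltL]; first exact: enumerates_short.
by apply: enumerates_rec => //; apply: IH; lia.
Qed.

Lemma enumerates_factorsP L : enumerates_factors L (factors L).
Proof. by apply: enumerates_factors_fuel; rewrite leq_addr. Qed.

Lemma size_mem_factors L u : u \in factors L -> size u = L.
Proof. by case: (enumerates_factorsP L) => _ h /h[]. Qed.

Lemma count_factors_rec (P : pred (seq bool)) L : 3 < L ->
  count P (factors L) = count (P \o mu_even L) (factors (uphalf L)) +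
                        count (P \o mu_odd L) (factors L./2.+1).
Proof.
move=> ltL; have e := enumerates_rec ltL (enumerates_factorsP _) (enumerates_factorsP _).
by rewrite (permP (enumerates_perm (enumerates_factorsP L) e)) count_cat !count_map.
Qed.

(** * Counting factors by the differences of three letters *)

Definition pattern (i j k : nat) (p q : bool) : pred (seq bool) := fun x =>
  (nth false x i (+) nth false x j == p) && (nth false x j (+) nth false x k == q).

Definition count_pattern (L i j k : nat) (p q : bool) : nat :=
  count (pattern i j k p q) (factors L).

(** Taking images under [mu] changes a letter only by the parity of its position, so differences of
    letters pull back to differences shifted by known constants. *)
Lemma count_pattern_rec L i j k p q : 3 < L -> i < L -> j < L -> k < L ->
  count_pattern L i j k p q =
    count_pattern (uphalf L) i./2 j./2 k./2
      (p (+) odd i (+) odd j) (q (+) odd j (+) odd k) +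
    count_pattern L./2.+1 (uphalf i) (uphalf j) (uphalf k)
      (p (+) odd i (+) odd j) (q (+) odd j (+) odd k).
Proof.
move=> ltL lti ltj ltk; rewrite /count_pattern count_factors_rec //.
congr (_ + _); apply: eq_in_count => x /size_mem_factors sx; rewrite /pattern /=.
  rewrite !nth_mu_even ?sx //.
  by do 3 case: (nth false x _); case: p; case: q; case: (odd i); case: (odd j); case: (odd k).
rewrite !nth_mu_odd ?sx //.
by do 3 case: (nth false x _); case: p; case: q; case: (odd i); case: (odd j); case: (odd k).
Qed.

(** The four patterns partition the factors; this expresses factor counts at the lengths 2n + 1 and
    2n + 2 through pattern counts. *)
Lemma size_factors_pattern L i j k :
  size (factors L) = count_pattern L i j k false false + count_pattern L i j k false true
                   + count_pattern L i j k true false + count_pattern L i j k true true.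
Proof.
rewrite /count_pattern; elim: (factors L) => //= x s ->; rewrite /pattern.
by case: (_ (+) _); case: (_ (+) _) => /=; lia.
Qed.

(** * Abelian squares in terms of their preimages under [mu] *)

Definition balanced (n : nat) : pred (seq bool) := fun u =>
  count id u == (count id (take n u)).*2.

Lemma count_id_perm (u v : seq bool) :
  perm_eq u v = (size u == size v) && (count id u == count id v).
Proof.
apply/idP/andP=> [h | [/eqP sz /eqP cnt]].
  by rewrite (perm_size h) (permP h).
have cF s : count_mem false s = size s - count id s.
  by rewrite -(count_predC id s) addKn; apply: eq_count => -[].
have cT s : count_mem true s = count id s by apply: eq_count => -[].
by apply/allP=> -[] _ /=; rewrite ?cF ?cT ?sz cnt.
Qed.

(** Over two letters, halves of equal length are anagrams once they have equally many 1s. *)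
Lemma balancedP n (u : seq bool) : size u = n.*2 ->
  reflect (is_abelian_square u) (balanced n u).
Proof.
move=> su; apply: (iffP eqP) => [e | [u1 [u2 [eu pu]]]].
  exists (take n u), (drop n u); rewrite cat_take_drop; split=> //.
  rewrite count_id_perm size_take size_drop su.
  move: e; rewrite -{1}(cat_take_drop n u) count_cat => e.
  by apply/andP; split; apply/eqP; last lia; case: ltnP; lia.
have s1 : size u1 = n.
  by move: su; rewrite eu size_cat -(perm_size pu) addnn => /double_inj.
by rewrite eu take_size_cat // count_cat (permP pu) addnn.
Qed.

Lemma tm_abelian_squaresE n :
  tm_abelian_squares n = count (balanced n) (factors n.*2).
Proof.
have [uniq_f mem_f] := enumerates_factorsP n.*2.
rewrite /tm_abelian_squares cardE -(size_map val) -size_filter; apply: perm_size.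
apply: uniq_perm; rewrite ?filter_uniq ?(map_inj_uniq val_inj) ?enum_uniq // => u.
rewrite mem_filter; apply/mapP/andP => [[x] | [bu /mem_f [su fu]]].
  rewrite mem_enum inE => /asboolP [fx ax] ->.
  have sx : size x = n.*2 by rewrite size_tuple mul2n.
  by split; [apply/balancedP | apply/mem_f].
have su' : size u == 2 * n by rewrite su mul2n.
exists (Tuple su') => //; rewrite mem_enum inE; apply/asboolP; split=> //.
exact/(balancedP su).
Qed.

(** Each complete block has exactly one 1; an odd i adds the first letter of the next block. *)
Lemma count_take_mu y i : i <= (size y).*2 ->
  count id (take i (apply_morphism mu y)) = i./2 + odd i * nth false y i./2.
Proof.
elim: y i => [|a y IH] [|[|i]] //=.
rewrite doubleS !ltnS => /IH; rewrite /apply_morphism negbK => ->.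
by case: a; case: (odd i); rewrite /= ?mul0n ?mul1n; lia.
Qed.

(** The letter lost to [behead] is added back on the left to avoid truncated subtraction. *)
Lemma count_take_behead_mu y i : i < (size y).*2 ->
  count id (take i (behead (apply_morphism mu y))) + nth false y 0 =
  uphalf i + ~~ odd i * nth false y (uphalf i).
Proof.
move=> lti; have := @count_take_mu y i.+1 lti; rewrite /= => <-.
by case: y lti => //= a y _; rewrite addnC.
Qed.

(** The word has n blocks, hence n ones; for even n each half consists of n/2 whole blocks. *)
Lemma balanced_mu_even n y : size y = n ->
  balanced n (mu_even n.*2 y) = ~~ odd n.
Proof.
move=> sy; rewrite /balanced /mu_even take_takel ?count_take_mu ?sy; lia.
Qed.

(** The word lacks the first and last letters of [mu] applied to y, so it has n - y_0 + y_n ones.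
    For odd n its first half ends with a block, for even n it cuts the block of y_(n/2). *)
Lemma balanced_mu_odd n y : size y = n.+1 ->
  balanced n (mu_odd n.*2 y) =
    if odd n then nth false y 0 != nth false y n
    else (nth false y 0 == nth false y n./2) && (nth false y n./2 == nth false y n).
Proof.
move=> sy; rewrite /balanced /mu_odd take_takel; last by lia.
have := @count_take_behead_mu y n; have := @count_take_behead_mu y n.*2.
rewrite sy uphalf_double odd_double mul1n => /(_ _) h2 /(_ _) h1.
move: (h2 ltac:(lia)) (h1 ltac:(lia)); case on: (odd n) => /= {h1 h2}.
  case: (nth false y 0); case: (nth false y n) => /= e2 e1; lia.
have -> : uphalf n = n./2 by lia.
case: (nth false y 0); case: (nth false y n); case: (nth false y n./2) => /= e2 e1; lia.
Qed.

Lemma tm_abelian_squares_double n : 0 < n ->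
  tm_abelian_squares n.*2 =
    size (factors n.*2) + count_pattern n.*2.+1 0 n n.*2 false false.
Proof.
move=> n_gt0; rewrite tm_abelian_squaresE count_factors_rec; last by lia.
rewrite uphalf_double doubleK; congr (_ + _).
  rewrite -count_predT; apply: eq_in_count => x /size_mem_factors sx /=.
  by rewrite balanced_mu_even // odd_double.
apply: eq_in_count => x /size_mem_factors sx /=.
rewrite balanced_mu_odd // odd_double doubleK /pattern.
by do 3 case: (nth false x _).
Qed.

Lemma tm_abelian_squares_doubleS n : 0 < n ->
  tm_abelian_squares n.*2.+1 =
    count_pattern n.*2.+2 0 n n.*2.+1 false true +
    count_pattern n.*2.+2 0 n n.*2.+1 true false.
Proof.
move=> n_gt0; rewrite tm_abelian_squaresE count_factors_rec; last by lia.
rewrite uphalf_double doubleK.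
rewrite (@eq_in_count _ _ pred0) => [|x /size_mem_factors sx /=]; last first.
  by rewrite balanced_mu_even //= odd_double.
(* The ends differ exactly when the middle letter agrees with just one of them; these two cases are
   disjoint. *)
rewrite count_pred0 add0n /count_pattern -count_predUI.
rewrite (@eq_count _ (predI _ _) pred0) => [|x]; last first.
  by rewrite /= /pattern; do 2 case: (_ (+) _).
rewrite count_pred0 addn0; apply: eq_in_count => x /size_mem_factors sx /=.
rewrite balanced_mu_odd //= odd_double /pattern /=.
by do 3 case: (nth false x _).
Qed.

(** * The 18 sequences and their recursions *)

Inductive statistic :=
  | Triple of bool & bool
  | TripleS of bool & bool
  | Left of bool & bool
  | Right of bool & bool
  | Factors
  | Squares.

(** [TripleS] at n is [Triple] at n + 1; as a separate sequence it keeps all terms of the recursions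
    at index n. *)
Definition stat (x : statistic) (n : nat) : nat :=
  match x with
  | Triple p q => count_pattern n.*2.+1 0 n n.*2 p q
  | TripleS p q => count_pattern n.*2.+3 0 n.+1 n.*2.+2 p q
  | Left p q => count_pattern n.*2.+2 0 n n.*2.+1 p q
  | Right p q => count_pattern n.*2.+2 0 n.+1 n.*2.+1 p q
  | Factors => size (factors n.*2)
  | Squares => count (balanced n) (factors n.*2)
  end.

Definition all_bool2 (T : Type) (F : bool -> bool -> T) : seq T :=
  [:: F false false; F false true; F true false; F true true].

(** The negations record the parities of the middle and last positions, as in
    [count_pattern_rec]. *)
Definition stat_step (b : bool) (x : statistic) : seq statistic :=
  match x, b with
  | Triple p q, false => [:: Triple p q; Triple p q]
  | Triple p q, true | TripleS p q, false => [:: Left (~~ p) (~~ q); Right (~~ p) (~~ q)]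
  | TripleS p q, true => [:: TripleS p q; TripleS p q]
  | Left p q, false => [:: Triple p (~~ q); Left p (~~ q)]
  | Left p q, true => [:: Left (~~ p) q; TripleS (~~ p) q]
  | Right p q, false => [:: Triple (~~ p) q; Right (~~ p) q]
  | Right p q, true => [:: Right p (~~ q); TripleS p (~~ q)]
  | Factors, false => Factors :: all_bool2 Triple
  | Factors, true => all_bool2 Triple ++ all_bool2 Left
  | Squares, false => [:: Factors; Triple false false]
  | Squares, true => [:: Left false true; Left true false]
  end.

(* At n = 0 the identities fail: they use lengths that are at least 4. *)
Lemma stat_rec x (b : bool) n : 0 < n ->
  stat x (b + n.*2) = sumn [seq stat y n | y <- stat_step b x].
Proof.
move=> n_gt0.
have cp L L' i i' j j' k k' p p' q q' : L = L' -> i = i' -> j = j' -> k = k' ->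
    p = p' -> q = q' -> count_pattern L i j k p q = count_pattern L' i' j' k' p' q'.
  by move=> -> -> -> -> -> ->.
case: x => [p q|p q|p q|p q||]; rewrite [LHS]/stat.
- rewrite count_pattern_rec; try lia.
  by case: b; rewrite /= addn0; congr (_ + _); apply: cp; lia.
- rewrite count_pattern_rec; try lia.
  by case: b; rewrite /= addn0; congr (_ + _); apply: cp; lia.
- rewrite count_pattern_rec; try lia.
  by case: b; rewrite /= addn0; congr (_ + _); apply: cp; lia.
- rewrite count_pattern_rec; try lia.
  by case: b; rewrite /= addn0; congr (_ + _); apply: cp; lia.
- rewrite -count_predT count_factors_rec; last by lia.
  rewrite -[count _ (factors (uphalf _))]/(count predT _) -[count _ (factors _.+1)]/(count predT _).
  rewrite !count_predT.
  have -> : uphalf (b + n.*2).*2 = b + n.*2 by lia.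
  have -> : (b + n.*2).*2./2.+1 = (b + n.*2).+1 by lia.
  case: b; rewrite ?add0n ?add1n /=.
    by rewrite (size_factors_pattern n.*2.+1 0 n n.*2) (size_factors_pattern n.*2.+2 0 n n.*2.+1); lia.
  by rewrite (size_factors_pattern n.*2.+1 0 n n.*2); lia.
- rewrite -tm_abelian_squaresE; case: b; rewrite ?add0n ?add1n /= addn0.
    exact: tm_abelian_squares_doubleS.
  exact: tm_abelian_squares_double.
Qed.

(** * Matrix relations and their propagation along the digits *)

Import GRing.Theory.
Local Open Scope ring_scope.

(** Turns the sum into a fold that can be evaluated by computation. *)
Lemma sum_mx_of_rows m n s (i : 'I_m) (c : nat -> rat) :
  \sum_(j < n) mx_of_rows m n s i j * c j =
  let row := nth [::] s i in foldr (fun j z => nth 0 row j * c j + z) 0 (iota 0 n).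
Proof.
rewrite (eq_bigr (fun j : 'I_n => nth 0 (nth [::] s i) j * c j)) => [|j _]; last by rewrite mxE.
rewrite -(big_mkord xpredT (fun j => nth 0 (nth [::] s i) j * c j)) /index_iota subn0.
by elim: (iota 0 n) => [|j r IH]; rewrite ?big_nil // big_cons IH.
Qed.

Lemma stat_tm_M x (b : bool) (i : 'I_11) : (0 < i)%N ->
  (stat x (b + i.*2))%:R = \sum_(j < 11) tm_M b i j * (stat x j)%:R.
Proof.
(* Membership in an explicit list reduces the claim to evaluating [all] for each statistic and
   digit. *)
move=> i_gt0; have mem_i : (i : nat) \in iota 1 10.
  by rewrite mem_iota i_gt0 /= (ltn_ord i).
by case: b; rewrite /tm_M /tm_M0 /tm_M1 (sum_mx_of_rows _ _ _ (fun j => (stat x j)%:R));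
  apply/eqP; move: (nat_of_ord i) mem_i => {i i_gt0}; apply/allP;
  case: x => [[] []|[] []|[] []|[] []||]; vm_compute.
Qed.

Lemma tm_v_delta : tm_v = delta_mx 0 0.
Proof.
apply/matrixP => i j; rewrite !mxE !ord1 /=.
by case: j => [] [|[|[|[|[|[|[|[|[|[|[|j]]]]]]]]]]].
Qed.

(** Here [a] lists the digits after the leading 1. *)
Definition stat_row (a : seq bool) : 'rV[rat]_11 :=
  tm_v *m \prod_(c <- true :: a) tm_M c.

Lemma stat_row_nil j : stat_row [::] 0 j = tm_M1 0 j.
Proof. by rewrite /stat_row big_seq1 tm_v_delta -rowE mxE. Qed.

Lemma stat_row_rcons a b : stat_row (rcons a b) = stat_row a *m tm_M b.
Proof. by rewrite /stat_row -rcons_cons big_rcons /= mulmxA. Qed.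

(* The first basis vector leaves the orbit at the leading digit 1; this is what
   allows stat_rec and stat_tm_M to be used for positive indices only. *)
Lemma stat_row_ord0 a : stat_row a 0 0 = 0.
Proof.
elim/last_ind: a => [|a b IH]; first by rewrite stat_row_nil !mxE.
rewrite stat_row_rcons mxE big1 // => i _.
case: i => [] [|i] lti.
  by rewrite (_ : Ordinal lti = 0) ?IH ?mul0r //; apply: val_inj.
rewrite (_ : tm_M b _ _ = 0) ?mulr0 //.
by case: b; rewrite mxE; move: i lti; do 10?[case=> //].
Qed.

Lemma sum_tm_M1_ord0 (c : nat -> rat) : \sum_(j < 11) tm_M1 0 j * c j = c 1%N.
Proof. by rewrite sum_mx_of_rows /= !mul0r mul1r !addr0 add0r. Qed.

(** The induction carries all statistics together, since the recursion for one involves others. *)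
Lemma stat_expansion a (n := foldl (fun m (b : bool) => m * 2 + b)%N 1%N a) :
  (0 < n)%N /\
  forall x, (stat x n)%:R = \sum_(j < 11) stat_row a 0 j * (stat x j)%:R.
Proof.
rewrite {}/n; elim/last_ind: a => [|a b [n_gt0 IH]].
  split=> // x; under eq_bigr do rewrite stat_row_nil.
  by rewrite (sum_tm_M1_ord0 (fun j => (stat x j)%:R)).
rewrite -cats1 foldl_cat /=; set n := foldl _ _ a in n_gt0 IH *.
split=> [|x]; first by rewrite addn_gt0 muln_gt0 n_gt0.
rewrite cats1 stat_row_rcons.
(* The middle term meets the left side by [stat_rec], at n and at each i > 0, and the right side by
   [stat_tm_M]. *)
transitivity (\sum_(i < 11) stat_row a 0 i * (stat x (b + i.*2))%:R).
  rewrite muln2 addnC stat_rec // sumnE big_map natr_sum.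
  under eq_bigr do rewrite IH.
  rewrite exchange_big; apply: eq_bigr => i _ /=.
  have [i0|i_gt0] := posnP i; last by rewrite stat_rec // sumnE big_map natr_sum mulr_sumr.
  have -> : i = 0 by apply: val_inj.
  by rewrite stat_row_ord0 big1 ?mul0r // => y _; rewrite mul0r.
under [RHS]eq_bigr do rewrite mxE mulr_suml.
rewrite exchange_big; apply: eq_bigr => i _ /=.
under eq_bigr do rewrite -mulrA.
rewrite -mulr_sumr; have [i0|i_gt0] := posnP i; last by rewrite stat_tm_M.
have -> : i = 0 by apply: val_inj.
by rewrite stat_row_ord0 !mul0r.
Qed.

Lemma tm_w_stat (j : 'I_11) : tm_w j 0 = (stat Squares j)%:R.
Proof.
by rewrite !mxE; case: j => [] [|[|[|[|[|[|[|[|[|[|[|j]]]]]]]]]]] // ltj; apply/eqP; vm_compute.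
Qed.

Theorem theorem9 :
  (forall (n : nat) (a : seq bool), is_base2_rep n a ->
     (tm_abelian_squares n)%:R = (tm_v *m (\prod_(b <- a) tm_M b) *m tm_w) 0 0)
  /\ two_regular (fun n : nat => (tm_abelian_squares n)%:R).
Proof.
have rep : forall (n : nat) (a : seq bool), is_base2_rep n a ->
    (tm_abelian_squares n)%:R = (tm_v *m (\prod_(b <- a) tm_M b) *m tm_w) 0 0.
  (* For the empty word, v selects the entry of w equal to f(0). Otherwise the leading digit is 1
     and starts the fold of [stat_expansion] at 1. *)
  move=> n [|b a] [/=]; first by move=> _ ->;
    rewrite big_nil mulmx1 tm_v_delta -rowE mxE tm_w_stat tm_abelian_squaresE.
  move=> -> ->; rewrite tm_abelian_squaresE -/(stat Squares _).
  have [_ ->] := stat_expansion a; rewrite [RHS]mxE.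
  by apply: eq_bigr => j _; rewrite tm_w_stat.
by split=> //; exists 11, tm_v, tm_M, tm_w.
Qed.
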